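(* Let $G$ be a finite group and let $H\subseteq G$ be a subgroup. In the ribbon operator algebra $\mathfrak{C}$ of $G$ (with basis $\hat F^{g,h}$, $g,h\in G$), put $$\hat A_H=\frac{1}{|H|}\sum_{h_1,h_2\in H}\hat F^{h_1,h_2}.$$ Then $\hat A_H$ satisfies the consistency conditions for boundary terms, i.e. $$\hat A_H^2=\hat A_H,\qquad \hat A_H\,\hat\Omega=\hat\Omega,\qquad \mathbf S[\hat A_H]=\hat A_H,\qquad \mathbf T[\hat A_H]=\hat A_H .$$
   Context: For a finite group $G$ with identity $e$, the ribbon operators of the $G$-quantum double model along a fixed path form a complex associative algebra $\mathfrak{C}$ with linear basis $\{\hat F^{g,h}\}_{g,h\in G}$ and multiplication $$\hat F^{g_1,h_1}\hat F^{g_2,h_2}=\delta_{g_1,g_2}\,\hat F^{g_1,h_1h_2}.$$ The element $\hat\Omega$ is $$\hat\Omega=\frac1{|G|}\sum_{g\in G}\hat F^{e,g}.$$ The maps $\mathbf S,\mathbf T:\mathfrak{C}\to\mathfrak{C}$ are the linear maps (not algebra homomorphisms in general) defined on the basis by $$\mathbf S[\hat F^{g,h}]=\hat F^{h,g^{-1}},\qquad \mathbf T[\hat F^{g,h}]=\hat F^{g,gh}.$$ An element $\hat A\in\mathfrak{C}$ is said to satisfy the consistency conditions for boundary terms if $\hat A^2=\hat A$, $\hat A\hat\Omega=\hat\Omega$, $\mathbf S[\hat A]=\hat A$ and $\mathbf T[\hat A]=\hat A$. *)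

(* Defs.v *)
From HB Require Import structures.
From mathcomp Require Import all_boot all_order all_algebra all_fingroup.

Set Implicit Arguments.
Unset Strict Implicit.
Unset Printing Implicit Defensive.

Import GRing.Theory.
Local Open Scope ring_scope.

(* The alias hides the pointwise product that the library puts on finite
   functions: only the vector space structure is inherited. The value of a at
   (g, h) is the coordinate of a along F^{g,h}. *)
Definition ribbon (K : fieldType) (gT : finGroupType) : Type :=
  {ffun gT * gT -> K^o}.

HB.instance Definition _ (K : fieldType) (gT : finGroupType) :=
  Vector.copy (ribbon K gT) {ffun gT * gT -> K^o}.

Section RibbonAlgebra.
Variables (K : fieldType) (gT : finGroupType).
Implicit Types (a b c : ribbon K gT) (g h : gT) (p : gT * gT).

Definition ribbonF g h : ribbon K gT := [ffun p => (p == (g, h))%:R].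

Lemma ribbonFE g h p : ribbonF g h p = (p == (g, h))%:R.
Proof. by rewrite ffunE. Qed.

Lemma ribbon_expand a : a = \sum_p a p *: ribbonF p.1 p.2.
Proof.
apply/ffunP => q; rewrite sum_ffunE (bigD1 q) //= big1 => [|p /negPf pq].
  by rewrite !ffunE -surjective_pairing eqxx addr0 [_ *: _]mulr1.
by rewrite !ffunE -surjective_pairing eq_sym pq [_ *: _]mulr0.
Qed.

Lemma ribbon_coord (x : gT * gT -> K) q :
  (\sum_p x p *: ribbonF p.1 p.2 : ribbon K gT) q = x q.
Proof.
rewrite sum_ffunE (bigD1 q) //= big1 => [|p /negPf pq].
  by rewrite !ffunE -surjective_pairing eqxx addr0 [_ *: _]mulr1.
by rewrite !ffunE -surjective_pairing eq_sym pq [_ *: _]mulr0.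
Qed.

(* The linear map sending F^{g,h} to f (g, h). *)
Definition linext (f : gT * gT -> ribbon K gT) a : ribbon K gT :=
  \sum_p a p *: f p.

Lemma linext_is_linear f : linear (linext f).
Proof.
move=> k a b; rewrite /linext scaler_sumr -big_split /=.
by apply: eq_bigr => p _; rewrite !ffunE scalerDl scalerA.
Qed.

HB.instance Definition _ f :=
  GRing.isLinear.Build K (ribbon K gT) (ribbon K gT) _ (linext f)
    (linext_is_linear f).

Lemma linextF f g h : linext f (ribbonF g h) = f (g, h).
Proof.
rewrite /linext (bigD1 (g, h)) //= big1 => [|p /negPf pgh].
  by rewrite !ffunE eqxx scale1r addr0.
by rewrite !ffunE pgh scale0r.
Qed.

Lemma ribbon_ind (P : ribbon K gT -> Prop) :
    P 0 -> (forall k a b, P a -> P b -> P (k *: a + b)) ->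
    (forall g h, P (ribbonF g h)) ->
  forall a, P a.
Proof.
move=> P0 PD PF a; rewrite [a]ribbon_expand; elim: (index_enum _) => [|p r IHr].
  by rewrite big_nil.
by rewrite big_cons; apply: PD.
Qed.

Definition ribbon_mul a b : ribbon K gT :=
  linext (fun p => linext (fun q =>
    if p.1 == q.1 then ribbonF p.1 (p.2 * q.2)%g else 0) b) a.

Definition ribbon_one : ribbon K gT := \sum_g ribbonF g 1%g.

Fact ribbon_mulFF g1 h1 g2 h2 : ribbon_mul (ribbonF g1 h1) (ribbonF g2 h2)
  = if g1 == g2 then ribbonF g1 (h1 * h2)%g else 0.
Proof. by rewrite /ribbon_mul !linextF. Qed.

Fact ribbon_mulPl k a b c :
  ribbon_mul (k *: a + b) c = k *: ribbon_mul a c + ribbon_mul b c.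
Proof. exact: linearP. Qed.

Fact ribbon_mulPr k a b c :
  ribbon_mul a (k *: b + c) = k *: ribbon_mul a b + ribbon_mul a c.
Proof.
rewrite /ribbon_mul {1 3 5}/linext scaler_sumr -big_split /=.
apply: eq_bigr => p _; rewrite linearP scalerDr.
by rewrite !scalerA mulrC.
Qed.

Fact ribbon_mul0l a : ribbon_mul 0 a = 0.
Proof. exact: linear0. Qed.

Fact ribbon_mul0r a : ribbon_mul a 0 = 0.
Proof.
have /eqP := ribbon_mulPr 1 a 0 0.
by rewrite !scale1r addr0 -subr_eq subrr => /eqP.
Qed.

Fact ribbon_mulDl : left_distributive ribbon_mul +%R.
Proof. by move=> a b c; have := ribbon_mulPl 1 a b c; rewrite !scale1r. Qed.

Fact ribbon_mulDr : right_distributive ribbon_mul +%R.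
Proof. by move=> a b c; have := ribbon_mulPr 1 a b c; rewrite !scale1r. Qed.

Fact ribbon_mulZl k a b : k *: ribbon_mul a b = ribbon_mul (k *: a) b.
Proof. by have := ribbon_mulPl k a 0 b; rewrite ribbon_mul0l !addr0. Qed.

Fact ribbon_mulZr k a b : k *: ribbon_mul a b = ribbon_mul a (k *: b).
Proof. by have := ribbon_mulPr k a b 0; rewrite ribbon_mul0r !addr0. Qed.

Fact ribbon_mul1 : left_id ribbon_one ribbon_mul.
Proof.
elim/ribbon_ind => [|k a b IHa IHb|g h]; first exact: ribbon_mul0r.
  by rewrite ribbon_mulPr IHa IHb.
rewrite (big_morph (ribbon_mul^~ _) (fun a b => ribbon_mulDl a b _)
  (ribbon_mul0l _)) (bigD1 g) //= big1 => [|i /negPf ig].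
  by rewrite ribbon_mulFF eqxx mul1g addr0.
by rewrite ribbon_mulFF ig.
Qed.

Fact ribbon_mulr1 : right_id ribbon_one ribbon_mul.
Proof.
elim/ribbon_ind => [|k a b IHa IHb|g h]; first exact: ribbon_mul0l.
  by rewrite ribbon_mulPl IHa IHb.
rewrite (big_morph (ribbon_mul _) (ribbon_mulDr _) (ribbon_mul0r _)).
rewrite (bigD1 g) //= big1 => [|i /negPf ig].
  by rewrite ribbon_mulFF eqxx mulg1 addr0.
by rewrite ribbon_mulFF eq_sym ig.
Qed.

Fact ribbon_mulA : associative ribbon_mul.
Proof.
move=> a b c; elim/ribbon_ind: a => [|k a a' IHa IHa'|g1 h1].
- by rewrite !ribbon_mul0l.
- by rewrite !ribbon_mulPl IHa IHa'.
elim/ribbon_ind: b => [|k b b' IHb IHb'|g2 h2].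
- by rewrite !(ribbon_mul0l, ribbon_mul0r).
- by rewrite !(ribbon_mulPl, ribbon_mulPr) IHb IHb'.
elim/ribbon_ind: c => [|k c c' IHc IHc'|g3 h3].
- by rewrite !ribbon_mul0r.
- by rewrite !ribbon_mulPr IHc IHc'.
rewrite !ribbon_mulFF.
case: (eqVneq g2 g3) => [<-|/negPf g23].
  rewrite ribbon_mulFF; case: eqP => [->|_]; last by rewrite ribbon_mul0l.
  by rewrite ribbon_mulFF eqxx mulgA.
rewrite ribbon_mul0r; case: eqP => [->|_]; last by rewrite ribbon_mul0l.
by rewrite ribbon_mulFF g23.
Qed.

Fact ribbon_one_neq0 : ribbon_one != 0.
Proof.
apply/eqP => /ffunP /(_ (1%g, 1%g)); rewrite sum_ffunE (bigD1 1%g) //=.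
rewrite big1 => [|i /negPf i1]; last by rewrite !ffunE xpair_eqE eq_sym i1.
by rewrite !ffunE eqxx addr0 => /eqP; rewrite (negPf (oner_neq0 K)).
Qed.

End RibbonAlgebra.

HB.instance Definition _ (K : fieldType) (gT : finGroupType) :=
  GRing.Zmodule_isNzRing.Build (ribbon K gT) (@ribbon_mulA K gT)
    (@ribbon_mul1 K gT) (@ribbon_mulr1 K gT) (@ribbon_mulDl K gT)
    (@ribbon_mulDr K gT) (@ribbon_one_neq0 K gT).
HB.instance Definition _ (K : fieldType) (gT : finGroupType) :=
  GRing.Lmodule_isLalgebra.Build K (ribbon K gT) (@ribbon_mulZl K gT).
HB.instance Definition _ (K : fieldType) (gT : finGroupType) :=
  GRing.Lalgebra_isAlgebra.Build K (ribbon K gT) (@ribbon_mulZr K gT).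

Section BoundaryTerms.
Variables (K : fieldType) (gT : finGroupType).
Local Notation F := (@ribbonF K gT).

Lemma ribbonFM g1 h1 g2 h2 :
  F g1 h1 * F g2 h2 = (g1 == g2)%:R *: F g1 (h1 * h2)%g.
Proof.
by rewrite [LHS]ribbon_mulFF; case: eqP; rewrite ?scale1r ?scale0r.
Qed.

Definition ribbonOmega : ribbon K gT := #|gT|%:R^-1 *: \sum_g F 1%g g.

Definition ribbonS : ribbon K gT -> ribbon K gT :=
  linext (fun p => F p.2 p.1^-1%g).
Definition ribbonT : ribbon K gT -> ribbon K gT :=
  linext (fun p => F p.1 (p.1 * p.2)%g).

HB.instance Definition _ := GRing.Linear.on ribbonS.
HB.instance Definition _ := GRing.Linear.on ribbonT.

Lemma ribbonSF g h : ribbonS (F g h) = F h g^-1%g.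
Proof. exact: linextF. Qed.

Lemma ribbonTF g h : ribbonT (F g h) = F g (g * h)%g.
Proof. exact: linextF. Qed.

Definition boundary_consistent (A : ribbon K gT) : Prop :=
  [/\ A ^+ 2 = A, A * ribbonOmega = ribbonOmega, ribbonS A = A
    & ribbonT A = A].

Definition ribbonA (H : {group gT}) : ribbon K gT :=
  #|H|%:R^-1 *: \sum_(h1 in H) \sum_(h2 in H) F h1 h2.

End BoundaryTerms.

Arguments ribbonF : clear implicits.
Arguments ribbonOmega : clear implicits.
Arguments ribbonA K {gT} H.

(* Main.v *)
(** Write [A = |H|^-1 *: \sum_(g in H) r_g] with rows [r_g := \sum_(h in H) F g h].
    Left translation by an element of [H] permutes [H] and also the whole
    group, so [r_g * r_k] is [|H| *: r_g] if [g = k] and [0] otherwise, and only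
    [r_1] acts on Omega, with eigenvalue [|H|].  The maps S and T permute the
    basis vectors indexed by [H * H]. *)
Require Import Defs.
From mathcomp Require Import all_boot all_order all_algebra all_fingroup.
From mathcomp Require Import complex reals.

Import GRing.Theory Num.Theory.
Local Open Scope ring_scope.

Section SubgroupBoundaryTerm.
Context {K : fieldType} {gT : finGroupType}.
Implicit Types (g h : gT) (H L : {group gT}).
Local Notation F := (ribbonF K gT).

(** Two subgroups are allowed so that it serves twice: [L = H] gives idempotence, and [L] the whole
    group gives the action on Omega. *)
Lemma ribbon_rowM H L g k : H \subset L ->
  (\sum_(h in H) F g h) * (\sum_(l in L) F k l)
    = ((g == k)%:R * #|H|%:R) *: \sum_(l in L) F g l.
Proof.
move=> sHL; rewrite mulr_suml.
rewrite (eq_bigr (fun=> (g == k)%:R *: \sum_(l in L) F g l)) => [|h Hh].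
  by rewrite sumr_const -scaler_nat scalerA mulrC.
(* For fixed [h], replacing [l] by [h * l] absorbs [h], which lies in [L]. *)
rewrite mulr_sumr scaler_sumr [RHS](reindex_inj (mulgI h)) /=.
apply: eq_big => [l|l _]; last exact: ribbonFM.
by rewrite groupMl // (subsetP sHL).
Qed.

Lemma ribbonA_idem H : #|H|%:R != 0 :> K -> ribbonA K H ^+ 2 = ribbonA K H.
Proof.
move=> nzH; rewrite expr2 /ribbonA -scalerAl -scalerAr; congr (_ *: _).
rewrite mulr_suml scaler_sumr; apply: eq_bigr => g Hg.
rewrite mulr_sumr (bigD1 g) //= [X in _ + X]big1 => [|k /andP[_ /negPf neq_kg]].
  by rewrite ribbon_rowM // eqxx mul1r addr0 scalerA mulVf ?scale1r.
by rewrite ribbon_rowM // eq_sym neq_kg mul0r scale0r.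
Qed.

Lemma ribbonA_Omega H : #|H|%:R != 0 :> K ->
  ribbonA K H * ribbonOmega K gT = ribbonOmega K gT.
Proof.
move=> nzH; rewrite /ribbonA /ribbonOmega -scalerAl -scalerAr scalerA mulrC.
rewrite -scalerA; congr (_ *: _).
(* Omega becomes a row over the full subgroup, as [ribbon_rowM] requires. *)
have -> : \sum_g F 1%g g = \sum_(g in [set: gT]%G) F 1%g g.
  by apply: eq_bigl => g; rewrite inE.
rewrite mulr_suml (bigD1 1%g) //=.
rewrite [X in _ + X]big1 => [|g /andP[_ /negPf neq_g1]].
  by rewrite ribbon_rowM ?subsetT // eqxx mul1r addr0 scalerA mulVf ?scale1r.
by rewrite ribbon_rowM ?subsetT // neq_g1 mul0r scale0r.
Qed.

Lemma ribbonS_ribbonA H : ribbonS (ribbonA K H) = ribbonA K H.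
Proof.
rewrite /ribbonA linearZ linear_sum; congr (_ *: _).
(* S sends the index [(g, h)] to [(h, g^-1)]: swap the two sums, then invert. *)
rewrite [RHS]exchange_big [RHS](reindex_inj invg_inj) /=.
apply: eq_big => [g|g _]; first by rewrite groupV.
rewrite linear_sum; apply: eq_bigr => h _; exact: ribbonSF.
Qed.

Lemma ribbonT_ribbonA H : ribbonT (ribbonA K H) = ribbonA K H.
Proof.
rewrite /ribbonA linearZ linear_sum; congr (_ *: _).
(* T preserves each row, translating its second index by [g] in [H]. *)
apply: eq_bigr => g Hg; rewrite linear_sum [RHS](reindex_inj (mulgI g)) /=.
by apply: eq_big => [h|h _]; [rewrite groupMl | exact: ribbonTF].
Qed.

Lemma ribbonA_consistent H :
  #|H|%:R != 0 :> K -> boundary_consistent (ribbonA K H).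
Proof.
move=> nzH; split; [exact: ribbonA_idem | exact: ribbonA_Omega | |].
  exact: ribbonS_ribbonA.
exact: ribbonT_ribbonA.
Qed.

End SubgroupBoundaryTerm.

Theorem mainTheorem1 (R : realType) (gT : finGroupType) (H : {group gT}) :
  boundary_consistent (ribbonA R[i] H).
Proof. by apply: ribbonA_consistent; rewrite pnatr_eq0 -lt0n cardG_gt0. Qed.
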